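(* Let $\mathbf{y}=(y_1,y_2,\dots,y_n)\in\mathbb{N}^n$, and define $\mathcal{W}(\mathbf{y})=\{w\in\mathbb{N}:(1^{n-1},w)\in\mathsf{PA}^{\mathrm{inv}}_n(\mathbf{y})\}$. (a) If $\mathbf{y}$ is non-constant (its entries are not all equal) and $w\in\mathcal{W}(\mathbf{y})$, then $w\le\sum_{j=1}^{n-1}y_j$. (b) We have $$\mathcal{W}(\mathbf{y})\subseteq\{1+\mathbf{b}^\top\mathbf{y}:\mathbf{b}\in\{0\}\times\{0,1\}^{n-1}\}\quad\text{and}\quad|\mathcal{W}(\mathbf{y})|\le 2^{n-1}.$$ (c) If $$y_j>\sum_{i=j+1}^{n}y_i\quad\text{for all }j\in[n-1],$$ then equality is achieved in (b), i.e. $\mathcal{W}(\mathbf{y})=\{1+\mathbf{b}^\top\mathbf{y}:\mathbf{b}\in\{0\}\times\{0,1\}^{n-1}\}$ and $|\mathcal{W}(\mathbf{y})|=2^{n-1}$. Moreover, $$|\mathsf{PA}^{\mathrm{inv}}_n(\mathbf{y})|=2^{n-1}n-n+1\quad\text{and}\quad|\mathsf{PA}^{\mathrm{inv},\uparrow}_n(\mathbf{y})|=2^{n-1}.$$ (d) Let $n\ge 2$. If equality is achieved in (b), i.e. $|\mathcal{W}(\mathbf{y})|=2^{n-1}$ (which forces equality in the inclusion as well), then $$y_1\ge y_2\quad\text{and}\quad y_j>\sum_{i=j+1}^{n}y_i\quad\text{for all }j\in[n-1]\setminus\{1\}.$$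
   Context: $\mathbb{N}=\{1,2,3,\dots\}$ and $[n]=\{1,\dots,n\}$ (with $[0]=\emptyset$). Let $\mathbf{y}=(y_1,\dots,y_n)\in\mathbb{N}^n$ and $m=\sum_{i=1}^n y_i$. Consider a one-way street with $m$ parking spots numbered $1,\dots,m$ and $n$ cars entering in order $1,2,\dots,n$, where car $i$ has length $y_i$ and prefers spot $x_i\in[m]$. Car $i$ drives to spot $x_i$ and parks in $x_i,x_i+1,\dots,x_i+y_i-1$ if these spots exist and are all unoccupied; otherwise it parks in the next $y_i$ contiguous available spots, i.e. it occupies $s,s+1,\dots,s+y_i-1$ for the smallest $s\ge x_i$ such that $s+y_i-1\le m$ and all these spots are unoccupied; if no such $s$ exists, parking fails. The vector $\mathbf{x}=(x_1,\dots,x_n)\in[m]^n$ is a parking assortment for $\mathbf{y}$ if all cars can park; the set of these is $\mathsf{PA}_n(\mathbf{y})$. A parking assortment $\mathbf{x}$ is (permutation) invariant if every permutation of its entries is also in $\mathsf{PA}_n(\mathbf{y})$; $\mathsf{PA}^{\mathrm{inv}}_n(\mathbf{y})$ is the set of invariant parking assortments for $\mathbf{y}$, and $\mathsf{PA}^{\mathrm{inv},\uparrow}_n(\mathbf{y})\subseteq\mathsf{PA}^{\mathrm{inv}}_n(\mathbf{y})$ is its subset of nondecreasing elements. $(1^{n-1},w)$ denotes the vector $(1,\dots,1,w)$ with $n-1$ leading ones, and $\mathbf{b}^\top\mathbf{y}=\sum_{i=1}^n b_iy_i$. *)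

(* Defs.v *)
From mathcomp Require Import all_boot.
From mathcomp Require Import boolp classical_sets functions cardinality.

Set Implicit Arguments.
Unset Strict Implicit.
Unset Printing Implicit Defensive.

Local Open Scope classical_set_scope.

(* Spots are numbered from 1 to m, and [occ] lists the occupied ones.
   For l >= 1, [s + l <= m.+1] says that the last spot s + l - 1 exists. *)
Definition fits (m : nat) (occ : seq nat) (l s : nat) : bool :=
  (s + l <= m.+1) && all (fun k => k \notin occ) (iota s l).

(* The least s >= a at which a car of length l fits, if any. It is a itself
   when the preferred spots are available, so the two cases of the parking rule
   need not be distinguished. *)
Definition parking_spot (m : nat) (occ : seq nat) (a l : nat) : option nat :=
  ohead [seq s <- iota a (m.+1 - a) | fits m occ l s].

(* Each car is a pair (preference, length); cars enter in the order of the
   list. *)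
Fixpoint all_park (m : nat) (occ : seq nat) (cars : seq (nat * nat)) : bool :=
  if cars is (a, l) :: cars' then
    if parking_spot m occ a l is Some s then all_park m (iota s l ++ occ) cars'
    else false
  else true.

Section Assortments.
Variables (n : nat) (y : n.-tuple nat).

Definition PA : set (n.-tuple nat) :=
  [set x | all (fun a => 1 <= a <= sumn y) x
           /\ all_park (sumn y) [::] (zip x y)].

Definition PAinv : set (n.-tuple nat) :=
  [set x | PA x /\ forall x' : n.-tuple nat, perm_eq x' x -> PA x'].

Definition PAinv_nondecreasing : set (n.-tuple nat) :=
  [set x | PAinv x /\ sorted leq x].

(* The vector (1^(n-1), w). *)
Definition ones_then (w : nat) : n.-tuple nat :=
  [tuple if i.+1 == n then w else 1 | i < n].

Definition W : set nat := [set w | 0 < w /\ PAinv (ones_then w)].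

(* The numbers 1 + b^T y, for 0/1 vectors b whose first entry is 0. *)
Definition shifted_subset_sums : set nat :=
  [set 1 + \sum_(i < n) tnth b i * tnth y i
     | b in [set b : n.-tuple bool | nth false b 0 = false]].

End Assortments.

(* Main.v *)
(* If w is at position i + 1 and all other preferences are 1, the first i cars
   fill an initial segment, the next one parks at w, and the others fill the
   hole in between by first fit; all cars park iff no hole remains. So w is in
   W(y) iff, for every i, first fit with y_{i+2}, ..., y_n fills a hole of
   size w - 1 - (y_1 + ... + y_i) exactly. The case i = 0 makes w - 1 a subset
   sum of y_2, ..., y_n, and i = n - 1, n - 2, ... successively give (a). First
   fit finds every subset sum, each from a single subset, iff the sequence is
   superdecreasing, whence (c) and (d). For the counts in (c), put the least
   entry a <> 1 of an invariant x first: the hole of size a - 1 is filled by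
   cars preferring 1. If x had a second entry other than 1, rearranging it would
   give two subsets with the same sum. *)
Require Import Defs.
From mathcomp Require Import all_boot zify.
From mathcomp Require Import boolp classical_sets functions cardinality.

Set Implicit Arguments.
Unset Strict Implicit.

Local Open Scope classical_set_scope.
Local Open Scope card_scope.

(** * First fit, subset sums and superdecreasing sequences *)

(* First fit of the lengths [s] in a hole of size [r]: [greedy] marks the
   lengths that are placed and [leftover] is the part of the hole that stays empty. *)
Fixpoint greedy (r : nat) (s : seq nat) : bitseq :=
  if s is l :: s' then
    (l <= r) :: greedy (if l <= r then r - l else r) s'
  else [::].

Fixpoint leftover (r : nat) (s : seq nat) : nat :=
  if s is l :: s' then leftover (if l <= r then r - l else r) s' else r.

Fixpoint superdecreasing (s : seq nat) : bool :=
  if s is l :: s' then (sumn s' < l) && superdecreasing s' else true.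

Lemma size_greedy r s : size (greedy r s) = size s.
Proof. by elim: s r => //= l s IHs r; rewrite IHs. Qed.

Lemma sumn_mask_le (b : bitseq) s : sumn (mask b s) <= sumn s.
Proof.
elim: s b => [|l s IHs] [|[] b] //=; first by rewrite leq_add2l IHs.
by rewrite (leq_trans (IHs b)) ?leq_addl.
Qed.

Lemma sumn_greedy r s : sumn (mask (greedy r s) s) + leftover r s = r.
Proof.
elim: s r => //= l s IHs r; case: leqP => lr /=; last exact: IHs.
by rewrite -addnA IHs subnKC.
Qed.

Lemma leftover0_le r s : leftover r s = 0 -> r <= sumn s.
Proof. by move=> r0; rewrite -{1}(sumn_greedy r s) r0 addn0 sumn_mask_le. Qed.

Lemma leftover0 s : leftover 0 s = 0.
Proof. by elim: s => //= l s IHs; rewrite sub0n if_same. Qed.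

(** A length outside the subset exceeds the sum of all later lengths, so it does not fit in what
    remains of the hole; a length in the subset always fits. *)
Lemma greedy_superdecreasing s (b : bitseq) :
  superdecreasing s -> size b = size s -> greedy (sumn (mask b s)) s = b.
Proof.
elim: s b => [|l s IHs] [|c b] //= /andP[sl sds] [sb].
have bl : sumn (mask b s) < l := leq_ltn_trans (sumn_mask_le b s) sl.
by case: c => /=; [rewrite leq_addr addKn | rewrite leqNgt bl]; rewrite IHs.
Qed.

Lemma leftover_superdecreasing s (b : bitseq) :
  superdecreasing s -> size b = size s -> leftover (sumn (mask b s)) s = 0.
Proof.
move=> sds sb; have := sumn_greedy (sumn (mask b s)) s.
rewrite greedy_superdecreasing //; lia.
Qed.

Lemma superdecreasing_greedy s :
  (forall b : bitseq, size b = size s -> greedy (sumn (mask b s)) s = b) ->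
  superdecreasing s.
Proof.
elim: s => //= l s IHs gs; apply/andP; split.
  (* The subset of all lengths but [l]: first fit skips [l] only if the others sum to less than
     [l]. *)
  have := gs (false :: nseq (size s) true); rewrite /= size_nseq mask_true //.
  by move=> /(_ erefl) [/negbT]; rewrite -ltnNge.
apply: IHs => b sb; have := gs (false :: b); rewrite /= sb.
by move=> /(_ erefl) [->].
Qed.

Lemma superdecreasingP s :
  superdecreasing s <->
  (forall j, j < size s -> sumn (drop j.+1 s) < nth 0 s j).
Proof.
elim: s => [|l s IHs] //=; split=> [/andP[sl /IHs sds] [|j]|sds].
- by rewrite drop0.
- exact: sds.
apply/andP; split; first by have := sds 0 isT; rewrite /= drop0.
by apply/IHs => j js; apply: (sds j.+1).
Qed.

Lemma sumn_drop (s : seq nat) j :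
  sumn (drop j s) = \sum_(j <= i < size s) nth 0 s i.
Proof.
elim: s j => [|l s IHs] [|j] /=; try by rewrite big_geq.
  by rewrite big_nat_recl //= -IHs drop0.
by rewrite big_add1 /= IHs.
Qed.

Lemma sumn_take (s : seq nat) j : j <= size s ->
  sumn (take j s) = \sum_(0 <= i < j) nth 0 s i.
Proof.
elim: s j => [|l s IHs] [|j] //= js; try by rewrite big_geq.
by rewrite big_nat_recl //= -IHs.
Qed.

(* [drop i.+1 s] fills a hole of size [sumn (drop i s) - last 0 s]; the last
   term is moved to the left to avoid truncated subtraction. *)
Lemma suffix_sums_constant s :
  all (fun l => 0 < l) s ->
  (forall i, i < size s -> exists b : bitseq,
     sumn (mask b (drop i.+1 s)) + last 0 s = sumn (drop i s)) ->
  s = nseq (size s) (last 0 s).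
Proof.
elim: s => //= l s IHs /andP[l0 s0] sub.
case: s IHs s0 sub => [|l' s] //= IHs s0 sub; set c := last l' s.
have {}IHs : l' :: s = nseq (size s).+1 c.
  by apply: IHs => // i si; apply: (sub i.+1).
(* With [k] copies of [c] in the tail and [t] of them in the mask, the case [i = 0] reads
   [c * t + c = l + c * k]; as [l > 0], this forces [t = k] and [l = c]. *)
congr cons => //; case: (sub 0) => //= b.
have sE : l' + sumn s = sumn (nseq (size s).+1 c) by rewrite -IHs.
have ub : subseq (mask b (l' :: s)) (nseq (size s).+1 c).
  by rewrite -IHs mask_subseq.
have := size_subseq ub; have /all_pred1P-> : all (pred1 c) (mask b (l' :: s)).
  by apply/allP => x /(mem_subseq ub); rewrite mem_nseq => /andP[].
rewrite -/c sE !sumn_nseq !size_nseq; move: (size _) (size s).+1 => t k.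
case: ltngtP => // [tk _|->] cE; last lia.
by have := leq_mul (leqnn c) tk; rewrite mulnS; lia.
Qed.

(** * Parking when all preferences but one are 1 *)

Lemma parking_spot_some m occ a l s : parking_spot m occ a l = Some s ->
  a <= s /\ fits m occ l s.
Proof.
rewrite /parking_spot => psP.
have : s \in [seq s <- iota a (m.+1 - a) | fits m occ l s].
  by case: [seq _ <- _ | _] psP => //= x t [->]; rewrite mem_head.
by rewrite mem_filter mem_iota => /and3P[-> ->].
Qed.

Lemma parking_spotE m occ a l s : 0 < l -> a <= s -> fits m occ l s ->
  (forall t, a <= t < s -> ~~ fits m occ l t) ->
  parking_spot m occ a l = Some s.
Proof.
move=> l0 as_ fs nf; rewrite /parking_spot.
have sm : s <= m by case/andP: fs; lia.
have -> : m.+1 - a = (s - a) + (m - s).+1 by lia.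
rewrite iotaD filter_cat (eq_in_filter (a2 := pred0)).
  by rewrite filter_pred0 subnKC //= fs.
by move=> t; rewrite mem_iota subnKC // => /nf /negbTE.
Qed.

Lemma parking_spot_none m occ a l :
  (forall t, a <= t -> ~~ fits m occ l t) -> parking_spot m occ a l = None.
Proof.
move=> nf; case psP: (parking_spot _ _ _ _) => [s|] //.
by case: (parking_spot_some psP) => /nf /negbTE ->.
Qed.

Lemma eq_all_park m (occ1 occ2 : seq nat) cars : occ1 =i occ2 ->
  all_park m occ1 cars = all_park m occ2 cars.
Proof.
elim: cars occ1 occ2 => //= -[a l] cars IHc occ1 occ2 eocc.
have -> : parking_spot m occ1 a l = parking_spot m occ2 a l.
  rewrite /parking_spot; congr ohead; apply: eq_filter => s.
  by rewrite /fits; congr andb; apply: eq_all => k; rewrite eocc.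
case: (parking_spot _ _ _ _) => // s.
by apply: IHc => k; rewrite !mem_cat eocc.
Qed.

Lemma all_park_block m L ls cars :
  all (fun l => 0 < l) ls -> L + sumn ls <= m ->
  all_park m (iota 1 L) (zip (nseq (size ls) 1) ls ++ cars) =
  all_park m (iota 1 (L + sumn ls)) cars.
Proof.
elim: ls L => [|l ls IHls] L /=; first by rewrite addn0.
move=> /andP[l0 ls0] Lm; rewrite (@parking_spotE _ _ _ _ L.+1) //.
- rewrite addnA -IHls //; last by rewrite -addnA.
  by apply: eq_all_park => k; rewrite mem_cat !mem_iota; lia.
- apply/andP; split; first lia.
  by apply/allP => k; rewrite !mem_iota; lia.
- move=> t tL; apply/nandP; right; apply/allPn; exists t.
    by rewrite mem_iota; lia.
  by rewrite negbK mem_iota; lia.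
Qed.

(* The car at [w, w + d - 1] leaves the hole [L + 1, w - 1]; as the lengths add
   up to [m], the cars to come all park exactly when they fill that hole. *)
Lemma all_park_hole m L w d ls :
  all (fun l => 0 < l) ls -> 0 < d -> L < w -> w + d <= m.+1 ->
  L + d + sumn ls = m ->
  all_park m (iota w d ++ iota 1 L) (zip (nseq (size ls) 1) ls) =
  (leftover (w.-1 - L) ls == 0).
Proof.
elim: ls L d => [|l ls IHls] L d /=; first by lia.
move=> /andP[l0 ls0] d0 Lw wm Lm.
have noL t : 0 < t <= L -> ~~ fits m (iota w d ++ iota 1 L) l t.
  move=> tL; apply/nandP; right; apply/allPn; exists t.
    by rewrite mem_iota; lia.
  by rewrite negbK mem_cat !mem_iota; lia.
case: ifP => lr.
  rewrite (@parking_spotE _ _ _ _ L.+1) //.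
  - have -> : w.-1 - L - l = w.-1 - (L + l) by lia.
    rewrite -(IHls (L + l) d) //; [|lia..].
    by apply: eq_all_park => k; rewrite !mem_cat !mem_iota; lia.
  - apply/andP; split; first lia.
    by apply/allP => k; rewrite mem_cat !mem_iota; lia.
(* The car is longer than the hole, so from a start in the hole it reaches spot [w]; from a start in
   the block it meets [t] itself. *)
have nohole t : 0 < t < w + d -> ~~ fits m (iota w d ++ iota 1 L) l t.
  move=> twd; have [/(conj (proj1 (andP twd)))/andP/noL //|Lt] := leqP t L.
  apply/nandP; right; apply/allPn; exists (maxn t w).
    by rewrite mem_iota; lia.
  by rewrite negbK mem_cat !mem_iota; lia.
have [wdl|wdl] := leqP (w + d + l) m.+1.
  rewrite (@parking_spotE _ _ _ _ (w + d)) //; [|lia|].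
    rewrite -(IHls L (d + l)) //; [|lia..].
    by apply: eq_all_park => k; rewrite !mem_cat !mem_iota; lia.
  apply/andP; split; first lia.
  by apply/allP => k; rewrite mem_cat !mem_iota; lia.
(* The free space behind the block is shorter than [l], so the hole is longer than all of [ls]
   together and cannot be filled. *)
rewrite parking_spot_none => [|t t1]; last first.
  have [/(conj t1)/andP/nohole //|wdt] := ltnP t (w + d).
  by apply/nandP; left; lia.
by apply/esym/negbTE/eqP => /leftover0_le; lia.
Qed.

Lemma all_park_ones_but_one w ls1 l ls2 :
  all (fun l => 0 < l) (ls1 ++ l :: ls2) -> 0 < w ->
  all_park (sumn (ls1 ++ l :: ls2)) [::]
    (zip (nseq (size ls1) 1 ++ w :: nseq (size ls2) 1) (ls1 ++ l :: ls2)) =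
  (leftover (w.-1 - sumn ls1) ls2 == 0).
Proof.
rewrite all_cat /= => /and3P[ls10 l0 ls20] w0.
rewrite sumn_cat /= zip_cat ?size_nseq //= -[[::]]/(iota 1 0).
set m := _ + _; rewrite all_park_block //; last by rewrite /m; lia.
rewrite add0n; set L := sumn ls1.
have noL t : 0 < t <= L -> ~~ fits m (iota 1 L) l t.
  move=> tL; apply/nandP; right; apply/allPn; exists t.
    by rewrite mem_iota; lia.
  by rewrite negbK mem_iota; lia.
have fitL t : L < t -> fits m (iota 1 L) l t = (t + l <= m.+1).
  move=> Lt; rewrite /fits andb_idr // => _.
  by apply/allP => k; rewrite !mem_iota; lia.
(* If [w <= L.+1] there is no hole: the truncated difference is 0 and the cars line up from the
   left. *)
rewrite [LHS]/=; have [wL|Lw] := leqP w L.+1.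
  rewrite (@parking_spotE _ _ _ _ L.+1) //; first last.
  - by move=> t twL; apply: noL; lia.
  - by rewrite fitL //; rewrite /m; lia.
  have -> : w.-1 - L = 0 by lia.
  rewrite leftover0 eqxx -[zip _ _]cats0 (@eq_all_park _ _ (iota 1 (L + l))).
    by rewrite all_park_block // /m; lia.
  by move=> k; rewrite mem_cat !mem_iota; lia.
have [wlm|wlm] := leqP (w + l) m.+1.
  rewrite (@parking_spotE _ _ _ _ w) //; first last.
  - by move=> t; lia.
  - by rewrite fitL //; lia.
  by rewrite all_park_hole //; rewrite /m /L; lia.
rewrite parking_spot_none => [|t wt]; last by rewrite fitL; lia.
by apply/esym/negbTE/eqP => /leftover0_le; move: wlm; rewrite /m /L; lia.
Qed.

(** * Cars that fill the spots below an occupied spot *)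

Lemma count_lt_iota a s l :
  count (fun k => k < a) (iota s l) = minn l (a - s).
Proof. by elim: l s => [|l IHl] s /=; rewrite ?IHl; lia. Qed.

(* All spots get occupied, and a car with a spot below the occupied spot [a]
   has all its spots below [a]; [b] marks the cars that park there. *)
Lemma all_park_below m (occ : seq nat) cars (a : nat) :
  uniq occ -> {subset occ <= iota 1 m} -> all (fun c => 0 < c.1) cars ->
  size occ + sumn (unzip2 cars) = m -> a \in occ -> all_park m occ cars ->
  exists b : bitseq, [/\ size b = size cars,
    sumn (mask b (unzip2 cars)) + count (fun k => k < a) occ = a.-1 &
    forall j, nth false b j -> nth 0 (unzip1 cars) j < a].
Proof.
elim: cars occ => [|[p l] cars IHc] occ uocc socc /= cars0.
all: rewrite /= => szocc aocc.
  (* No car is left and [occ] has [m] distinct spots, so it is all of [1, ..., m], with [a - 1]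
     elements below [a]. *)
  move=> _; exists [::]; split=> // [/=|j]; last by rewrite nth_nil.
  have /(uniq_perm uocc (iota_uniq 1 m))/permP-> : occ =i iota 1 m.
    by apply: (uniq_min_size uocc socc _).2; rewrite size_iota -szocc addn0.
  have := socc _ aocc; rewrite mem_iota => am.
  by rewrite count_lt_iota /=; lia.
case/andP: cars0 => p0 cars0; case psP: parking_spot => [s|] // park.
have [ps /andP[sm /allP nocc]] := parking_spot_some psP.
have [|||||b [szb sumb prefb]] := IHc _ _ _ _ _ _ park.
- rewrite cat_uniq iota_uniq uocc andbT; apply/hasPn => k kocc.
  by apply/negP => /nocc; rewrite kocc.
- move=> k; rewrite mem_cat => /orP[|/socc //]; rewrite !mem_iota; lia.
- by [].
- by rewrite size_cat size_iota; lia.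
- by rewrite mem_cat aocc orbT.
(* Spot [a] is already taken, so the new car lies wholly on one side of it: the test [s < a] decides
   which, and then also [p <= s < a]. *)
have asl : ~~ (s <= a < s + l).
  by apply/negP => sal; have := nocc a; rewrite mem_iota sal aocc => /(_ isT).
exists ((s < a) :: b); split=> [|/=|[|j] //=]; first by rewrite /= szb.
  by rewrite count_cat count_lt_iota in sumb; case: ltnP => /=; lia.
  by move=> sa; apply: leq_ltn_trans sa.
exact: prefb.
Qed.

Lemma perm_ones_but_one (s : seq nat) w k : perm_eq s (w :: nseq k 1) ->
  exists i, i <= k /\ s = nseq i 1 ++ w :: nseq (k - i) 1.
Proof.
move=> sP; have ws : w \in s by rewrite (perm_mem sP) mem_head.
case/splitPr: s / ws sP => s1 s2 sP.
have {}sP : perm_eq (s1 ++ s2) (nseq k 1).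
  by move: sP; rewrite -[w :: s2]cat1s perm_catCA perm_cons.
have /all_pred1P : all (pred1 1) (s1 ++ s2).
  by rewrite (perm_all _ sP) all_nseq /= orbT.
have := perm_size sP; rewrite size_nseq size_cat => <- /eqP.
rewrite nseqD eqseq_cat ?size_nseq // => /andP[/eqP e1 /eqP e2].
by exists (size s1); rewrite leq_addr addKn -e1 -e2.
Qed.

Lemma card_uniq_seq (T : eqType) (s : seq T) :
  uniq s -> [set x | x \in s] #= `I_(size s).
Proof.
case: s => [|x0 s] us.
  rewrite (_ : [set x | _] = set0) ?II0 //.
  by apply/seteqP; split.
rewrite (_ : [set x | _] = nth x0 (x0 :: s) @` `I_(size (x0 :: s))).
  by apply: inj_card_eq => i j; rewrite !inE => si sj /eqP;
    rewrite nth_uniq // => /eqP.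
apply/seteqP; split=> x /=.
  by move=> xs; exists (index x (x0 :: s)); rewrite ?nth_index // index_mem.
by case=> i si <-; rewrite mem_nth.
Qed.

(** On the empty street the first car gets the spot [a] that it prefers if it parks at all. The
    spots before [a] are then left to later cars, to which [all_park_below] applies. *)
Lemma all_park_first_hole (l a : nat) ls xs :
  all (fun p => 0 < p) (a :: xs) -> size xs = size ls -> 0 < l ->
  all_park (sumn (l :: ls)) [::] (zip (a :: xs) (l :: ls)) ->
  exists b : bitseq, [/\ size b = size ls, sumn (mask b ls) = a.-1 &
    forall j, nth false b j -> nth 0 xs j < a].
Proof.
move=> /= /andP[a0 xs0] sxs l0; case psP: parking_spot => [s|] //.
have [as_ /andP[sl _]] := parking_spot_some psP.
have fa : fits (l + sumn ls) [::] l a.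
  by apply/andP; split; [lia | apply/allP].
have [->] : Some s = Some a.
  by rewrite -psP; apply: parking_spotE => // t; lia.
move=> /(all_park_below (a := a))[|||||b [szb sumb prefb]].
- by rewrite cats0 iota_uniq.
- by move=> k; rewrite cats0 !mem_iota; lia.
- by rewrite -(all_map fst) -/(unzip1 _) unzip1_zip // sxs.
- by rewrite unzip2_zip ?sxs // cats0 size_iota.
- by rewrite cats0 mem_iota; lia.
exists b; move: szb sumb prefb.
rewrite size_zip unzip1_zip ?unzip2_zip ?sxs // minnn cats0 count_lt_iota.
by rewrite subnn minn0 addn0.
Qed.

(** * Invariant assortments and vectors with at most one entry other than 1 *)

Definition one_other n (w : nat) i : n.-tuple nat :=
  [tuple if val j == i then w else 1 | j < n].

Lemma one_otherE n w i : i <= n ->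
  one_other n.+1 w i = nseq i 1 ++ w :: nseq (n - i) 1 :> seq nat.
Proof.
move=> le_in; apply: (@eq_from_nth _ 0) => [|j].
  by rewrite size_tuple size_cat /= !size_nseq; lia.
rewrite size_tuple => jn; rewrite -(tnth_nth 0 _ (Ordinal jn)) tnth_mktuple /=.
rewrite nth_cat size_nseq nth_nseq; case: ltngtP => // [ij|->].
  by have -> : j - i = (j - i).-1.+1; [lia | rewrite /= nth_nseq ifT //; lia].
by rewrite subnn.
Qed.

Lemma ones_thenE n w : ones_then n.+1 w = one_other n.+1 w n.
Proof. by []. Qed.

Lemma perm_one_other n w i : i <= n ->
  perm_eq (one_other n.+1 w i) (w :: nseq n 1).
Proof.
move=> le_in; rewrite one_otherE // -[w :: nseq (n - i) 1]cat1s perm_catCA.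
by rewrite perm_cons -nseqD subnKC.
Qed.

Lemma perm_one_otherP n (x : n.+1.-tuple nat) w :
  perm_eq x (w :: nseq n 1) -> exists2 i, i <= n & x = one_other n.+1 w i.
Proof.
move=> /perm_ones_but_one[i [le_in xE]]; exists i => //.
by apply: val_inj; rewrite /= xE -one_otherE.
Qed.

Section PositiveLengths.
Variables (n : nat) (y : n.+1.-tuple nat).
Hypothesis y_gt0 : all (fun l => 0 < l) y.

Lemma PA_one_other w i : 0 < w -> i <= n ->
  PA y (one_other n.+1 w i) <->
  w <= sumn y /\ leftover (w.-1 - sumn (take i y)) (drop i.+1 y) = 0.
Proof.
move=> w0 le_in.
have iy : i < size y by rewrite size_tuple.
have yE : y = take i y ++ nth 0 y i :: drop i.+1 y :> seq nat.
  by rewrite -drop_nth // cat_take_drop.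
have y0 := y_gt0; rewrite yE in y0.
have := all_park_ones_but_one y0 w0; rewrite -yE size_takel ?(ltnW iy) //.
rewrite size_drop size_tuple subSS -one_otherE // /PA /= => ->.
rewrite (perm_all _ (perm_one_other w le_in)) /= all_nseq w0 /=.
have -> : 0 < sumn y by rewrite yE sumn_cat; move: y0; rewrite all_cat /=; lia.
by rewrite orbT andbT; split=> -[-> /eqP].
Qed.

Lemma PAinv_perm (x x' : n.+1.-tuple nat) :
  perm_eq x' x -> PAinv y x -> PAinv y x'.
Proof.
move=> xx' [_ PAx]; split; first exact: PAx.
by move=> x'' /perm_trans/(_ xx')/PAx.
Qed.

(** The rearrangements to test are the vectors [one_other n.+1 w i] with [i <= n], each settled by
    [PA_one_other]. *)
Lemma W_leftover w : W y w <->
  0 < w /\ forall i, i <= n ->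
    leftover (w.-1 - sumn (take i y)) (drop i.+1 y) = 0.
Proof.
split=> [[w0 [_ PAw]]|[w0 lw]].
  split=> // i le_in; apply: (proj2 (proj1 (PA_one_other w0 le_in) _)).
  apply: PAw; rewrite ones_thenE (perm_trans (perm_one_other _ _)) //.
  by rewrite perm_sym perm_one_other.
have PAi i : i <= n -> PA y (one_other n.+1 w i).
  move=> le_in; apply/PA_one_other => //; split; last exact: lw.
  (* The bound [w <= sumn y]: by the case [i = 0], [w - 1] is at most the sum of all lengths but the
     first, which is positive. *)
  have y0n : 0 < size y by rewrite size_tuple.
  have := leftover0_le (lw 0 isT); have := y_gt0.
  rewrite take0 subn0; case: (tval y) y0n => //= l ls _ /andP[l0 _].
  by rewrite drop0; lia.
split=> //; split; first exact: PAi.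
move=> x; rewrite ones_thenE => /perm_trans/(_ (perm_one_other _ (leqnn n))).
by case/perm_one_otherP => i le_in ->; apply: PAi.
Qed.

Lemma PAinv_one_other w i : 0 < w -> i <= n ->
  PAinv y (one_other n.+1 w i) <-> W y w.
Proof.
have pij j k : j <= n -> k <= n ->
    perm_eq (one_other n.+1 w j) (one_other n.+1 w k).
  move=> jn kn; rewrite (perm_trans (perm_one_other _ jn)) // perm_sym.
  exact: perm_one_other.
move=> w0 le_in; rewrite /W /= ones_thenE; split=> [PAi|[_ PAn]].
  by split=> //; apply: (PAinv_perm _ PAi); apply: pij.
by apply: (PAinv_perm _ PAn); apply: pij.
Qed.

(** The hypothesis says that a subset of the later lengths is determined by its sum. It makes the
    set of cars before the first one independent of how the other preferences are arranged. *)
Lemma PAinv_one_otherP (x : n.+1.-tuple nat) :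
  (forall b1 b2 : bitseq, size b1 = n -> size b2 = n ->
    sumn (mask b1 (behead y)) = sumn (mask b2 (behead y)) -> b1 = b2) ->
  PAinv y x -> exists w i, [/\ i <= n, W y w & x = one_other n.+1 w i].
Proof.
move=> inj PAx.
have x0 : all (fun p => 0 < p) x.
  by case: PAx => [[/allP xm _] _]; apply/allP => p /xm /andP[].
suff [w xw] : exists w, perm_eq x (w :: nseq n 1).
  have w0 : 0 < w by move: x0; rewrite (perm_all _ xw) /= => /andP[].
  have [i le_in xE] := perm_one_otherP xw.
  by exists w, i; split=> //; apply/(PAinv_one_other w0 le_in); rewrite -xE.
(* Entries are positive, so those other than 1 are at least 2; sorting puts the least of them, [a],
   first. *)
set p := count_mem 1 x; set o := sort leq [seq k <- x | k != 1].
have xE : perm_eq x (nseq p 1 ++ o).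
  rewrite -(perm_filterC (pred1 1) x) perm_cat //.
    rewrite /p -size_filter; apply/permP => q; congr count.
    exact/all_pred1P/filter_all.
  by rewrite perm_sym perm_sort.
have osort : sorted leq o by apply: sort_sorted; apply: leq_total.
have o1 : all (fun k => 1 < k) o.
  rewrite all_sort all_filter; apply: sub_all x0 => k /=; lia.
have := perm_size xE; rewrite size_tuple size_cat size_nseq.
case: o => [|a [|b r]] in xE osort o1 *.
- by rewrite addn0 => pn; exists 1; rewrite cats0 -pn in xE.
- rewrite addn1 => -[pn]; exists a; rewrite -pn in xE.
  by rewrite (perm_trans xE) // perm_sym -cat1s perm_catC.
rewrite /= => szx; exfalso.
have hole s : perm_eq s (nseq p 1 ++ b :: r) ->
    exists c : bitseq, [/\ size c = n, sumn (mask c (behead y)) = a.-1 &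
      forall j, nth false c j -> nth 0 s j < a].
  move=> sE; have xs : perm_eq (a :: s) x.
    rewrite (perm_trans _ (_ : perm_eq (nseq p 1 ++ a :: b :: r) _)) //.
      by rewrite -[a :: b :: r]cat1s perm_sym perm_catCA perm_cons perm_sym.
    by rewrite perm_sym.
  have sz : size (a :: s) == n.+1 by rewrite (perm_size xs) size_tuple.
  have [_ parks] := proj2 PAx (Tuple sz) xs.
  have as0 : all (fun p => 0 < p) (a :: s) by rewrite (perm_all _ xs).
  move: (y_gt0) (size_tuple y) parks; case: (tval y) => //= l ls /andP[l0 _].
  move=> [szl] parks; rewrite -szl; apply: all_park_first_hole parks => //.
  by rewrite szl; move: sz => /= /eqP[].
have [c [szc sumc prefc]] := hole _ (perm_refl _).
have [a1 ab brge] : [/\ 1 < a, a <= b & all (leq a) (b :: r)].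
  move: o1 osort; rewrite /= => /and3P[-> _ _] /andP[ab].
  by move=> /(order_path_min leq_trans) rb; split=> //; rewrite ab /=;
    apply: sub_all rb => k; apply: leq_trans.
(* The hole has size [a - 1 > 0], so some car is marked in it. *)
have /hasP[j jn cj] : has (nth false c) (iota 0 n).
  apply/negPn/negP => /hasPn c0; suff c00 : c = nseq n false.
    by move: sumc; rewrite c00 mask_false /=; lia.
  rewrite -szc; apply/all_pred1P/(all_nthP false) => k kc.
  by apply/eqP/negbTE/c0; rewrite mem_iota -szc.
(* Every entry of [b :: r] is at least [a], so a car in the hole prefers 1. *)
have jp : j < p.
  rewrite ltnNge; apply/negP => pj; have := prefc j cj.
  rewrite nth_cat size_nseq [j < p]ltnNge pj /= ltnNge.
  move: jn; rewrite mem_iota => jn; rewrite (all_nthP 0 brge) //=; lia.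
(* Now [b] is moved to place [j]. By injectivity the mask is unchanged, so car [j] is still in the
   hole, although it prefers [b >= a]. *)
have [|c' [szc' sumc' prefc']] := hole (nseq j 1 ++ b :: nseq (p - j) 1 ++ r).
  rewrite -[b :: _ ++ _]cat1s -[b :: r]cat1s perm_catCA perm_sym perm_catCA.
  by rewrite perm_cat2l catA -nseqD subnKC // ltnW.
have := prefc' j; rewrite -(inj _ _ szc szc') ?sumc ?sumc' // => /(_ cj).
by rewrite nth_cat size_nseq ltnn subnn /= ltnNge ab.
Qed.

End PositiveLengths.

(** * Subset sums and the size of [W y] *)

Definition subset_sums n (y : n.+1.-tuple nat) : seq nat :=
  [seq (sumn (mask b (behead y))).+1 | b : n.-tuple bool].

(** The list ranges over masks and keeps repetitions; that distinct masks have distinct sums is the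
    separate property [uniq]. *)
Lemma size_subset_sums n (y : n.+1.-tuple nat) : size (subset_sums y) = 2 ^ n.
Proof. by rewrite size_image card_tuple card_bool. Qed.

Lemma sumn_mask (b : bitseq) (s : seq nat) :
  sumn (mask b s) = \sum_(i < size s) nth false b i * nth 0 s i.
Proof.
elim: s b => [|l s IHs] [|c b] /=; rewrite ?big_ord0 //.
  by rewrite big1 // => i _; rewrite nth_nil.
by rewrite big_ord_recl /= -IHs; case: c; rewrite ?mul1n.
Qed.

Lemma shifted_subset_sumsE n (y : n.+1.-tuple nat) :
  shifted_subset_sums y = [set w | w \in subset_sums y].
Proof.
have sE (b : n.+1.-tuple bool) :
    \sum_(i < n.+1) tnth b i * tnth y i = sumn (mask b y).
  rewrite sumn_mask size_tuple; apply: eq_bigr => i _.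
  by rewrite (tnth_nth false) (tnth_nth 0).
have yE : tval y = thead y :: behead y by rewrite [in LHS](tuple_eta y).
apply/seteqP; split=> w /=.
  case=> b /= b0 <-; rewrite sE; apply/fintype.imageP.
  exists [tuple of behead b] => //=; rewrite add1n; congr (_.+1).
  by rewrite yE; move: b0; case/tupleP: b => c b /= ->.
case/fintype.imageP => b _ ->; exists [tuple of false :: b] => //=.
by rewrite sE add1n yE.
Qed.

Section Cardinality.
Variables (n : nat) (y : n.+1.-tuple nat).
Hypothesis y_gt0 : all (fun l => 0 < l) y.

Lemma W_subset_sum w : W y w ->
  w = (sumn (mask (greedy w.-1 (behead y)) (behead y))).+1.
Proof.
move=> /(W_leftover y_gt0)[w0 /(_ 0 isT)]; rewrite take0 subn0 drop1 => r0.
by have := sumn_greedy w.-1 (behead y); rewrite r0 addn0 => ->; rewrite prednK.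
Qed.

Lemma W_sub_subset_sums : W y `<=` [set w | w \in subset_sums y].
Proof.
move=> w /W_subset_sum wE; apply/fintype.imageP.
have szg : size (greedy w.-1 (behead y)) == n.
  by rewrite size_greedy size_behead size_tuple.
by exists (Tuple szg).
Qed.

Lemma card_W_le : W y #<= `I_(2 ^ n).
Proof.
apply: card_le_trans (subset_card_le W_sub_subset_sums) _.
have -> : [set w | w \in subset_sums y] =
    [set w | w \in undup (subset_sums y)].
  by apply/seteqP; split=> w /=; rewrite mem_undup.
rewrite (card_le_eql (card_uniq_seq (undup_uniq _))) card_le_II.
by rewrite -(size_subset_sums y) size_undup.
Qed.

(** If [w] exceeds the sum of all lengths but the last, the case [i = n] of [W_leftover] forces
    [w - 1] to equal that sum. The case [i] then makes a suffix sum minus the last length a subset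
    sum of the next suffix, so [y] is constant. *)
Lemma W_le w : ~~ constant y -> W y w -> w <= sumn (take n y).
Proof.
move=> ncst /(W_leftover y_gt0)[w0 lw].
rewrite leqNgt; apply/negP => nw; case/negP: ncst.
have sumy : sumn (take n y) + last 0 y = sumn y.
  rewrite -[in RHS](cat_take_drop n y) sumn_cat; congr (_ + _).
  rewrite (drop_nth 0) ?size_tuple // -nth_last size_tuple /=.
  by rewrite drop_oversize ?size_tuple // addn0.
have wE : w.-1 = sumn (take n y).
  have := leftover0_le (lw n (leqnn n)).
  by rewrite drop_oversize ?size_tuple //=; lia.
have -> : tval y = nseq (size y) (last 0 y).
  apply: suffix_sums_constant => // i; rewrite size_tuple ltnS => le_in.
  exists (greedy (w.-1 - sumn (take i y)) (drop i.+1 y)).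
  have := sumn_greedy (w.-1 - sumn (take i y)) (drop i.+1 y).
  rewrite lw // addn0 => ->; rewrite wE.
  have : sumn (take i y) + sumn (drop i y) = sumn y.
    by rewrite -sumn_cat cat_take_drop.
  have : sumn (take n y) = sumn (take i y) + sumn (drop i (take n y)).
    by rewrite -sumn_cat -{1}(cat_take_drop i (take n y)) take_takel.
  by lia.
exact: constant_nseq.
Qed.

(** * Superdecreasing lengths: equality and exact counts *)

Section Superdecreasing.
Hypothesis y_sd : superdecreasing y.

Lemma mask_inj (b1 b2 : bitseq) : size b1 = n -> size b2 = n ->
  sumn (mask b1 (behead y)) = sumn (mask b2 (behead y)) -> b1 = b2.
Proof.
have : superdecreasing (behead y) by case: (tval y) y_sd => //= l s /andP[].
move=> sd b1n b2n e12.
rewrite -(greedy_superdecreasing sd (b := b1)) ?size_behead ?size_tuple //.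
by rewrite e12 greedy_superdecreasing ?size_behead ?size_tuple.
Qed.

Lemma uniq_subset_sums : uniq (subset_sums y).
Proof.
rewrite map_inj_uniq ?enum_uniq // => b1 b2 [e12]; apply: val_inj.
by apply: mask_inj => //; apply: size_tuple.
Qed.

Lemma W_superdecreasing : W y = [set w | w \in subset_sums y].
Proof.
apply/seteqP; split; first exact: W_sub_subset_sums.
move=> _ /fintype.imageP[b _ ->]; apply/(W_leftover y_gt0).
split=> // -[_|i le_in].
  rewrite take0 subn0 drop1; apply: leftover_superdecreasing.
    by case: (tval y) y_sd => //= l s /andP[].
  by rewrite size_behead !size_tuple.
(* For later positions there is no hole: [w - 1] is at most the sum of [behead y], which is less
   than the first length. *)
rewrite /= (_ : _ - _ = 0) ?leftover0 //; apply/eqP; rewrite subn_eq0.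
apply: leq_trans (sumn_mask_le _ _) _.
case: (tval y) y_sd => //= l s /andP[sl _].
exact: leq_trans (ltnW sl) (leq_addr _ _).
Qed.

Lemma card_W : W y #= `I_(2 ^ n).
Proof.
rewrite W_superdecreasing -(size_subset_sums y).
exact: card_uniq_seq uniq_subset_sums.
Qed.

Lemma PAinv_W (x : n.+1.-tuple nat) :
  PAinv y x <-> exists w i, [/\ i <= n, W y w & x = one_other n.+1 w i].
Proof.
split; first exact: (PAinv_one_otherP y_gt0 mask_inj).
case=> w [i [le_in Ww ->]].
exact/(PAinv_one_other y (proj1 Ww) le_in).
Qed.

Lemma PAinv_nondecreasing_W :
  PAinv_nondecreasing y = (fun w => one_other n.+1 w n) @` W y.
Proof.
have srt w : 0 < w -> sorted leq (one_other n.+1 w n).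
  move=> w0; rewrite one_otherE // subnn /=.
  by case: (n) => //= k; elim: k => /= [|k ->] //; rewrite andbT.
apply/seteqP; split=> x /=.
  case=> /PAinv_W[w [i [le_in Ww ->]]] sx; exists w => //.
  have w0 : 0 < w by case: Ww.
  apply/val_inj/(sorted_eq leq_trans anti_leq) => //; first exact: srt.
  rewrite (perm_trans (perm_one_other _ _)) // perm_sym.
  exact: perm_one_other.
case=> w Ww <-; have w0 : 0 < w by case: Ww.
by split; [apply/PAinv_W; exists w, n | apply: srt].
Qed.

Lemma card_PAinv_nondecreasing : PAinv_nondecreasing y #= `I_(2 ^ n).
Proof.
rewrite PAinv_nondecreasing_W; apply: card_eq_trans card_W.
apply: inj_card_eq => w1 w2 _ _ /(congr1 (fun x => tnth x ord_max)).
by rewrite !tnth_mktuple /= eqxx.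
Qed.

(** Each of the [2 ^ n - 1] values [w <> 1] gives [n.+1] vectors, one per position, while [w = 1]
    gives only the constant vector. *)
Lemma card_PAinv : PAinv y #= `I_(2 ^ n * n.+1 - n.+1 + 1).
Proof.
set s := rem 1 (subset_sums y).
have us : uniq s := rem_uniq _ uniq_subset_sums.
have s1 w : w \in s -> w != 1.
  by rewrite mem_rem_uniq ?uniq_subset_sums // inE => /andP[].
have sum1 : 1 \in subset_sums y.
  apply/fintype.imageP; exists [tuple of nseq n false] => //=.
  by rewrite mask_false.
pose F w (i : 'I_n.+1) := one_other n.+1 w i.
have FE w i : tnth (F w i) i = w by rewrite tnth_mktuple /= eqxx.
set L := one_other n.+1 1 0 :: [seq F w i | w <- s, i <- enum 'I_n.+1].
have one1 i : one_other n.+1 1 i = one_other n.+1 1 0.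
  by apply: eq_from_tnth => j; rewrite !tnth_mktuple !if_same.
have uL : uniq L.
  rewrite /= allpairs_uniq ?enum_uniq ?andbT //; last first.
    move=> [w1 i1] [w2 i2] /allpairsP[[u1 j1] /= [u1s _ [-> ->]]].
    move=> /allpairsP[[u2 j2] /= [u2s _ [-> ->]]] /= e12.
    (* Reading off coordinate [j1] of both vectors: its value [u1] is not 1, so the positions agree,
       and with them the values. *)
    have := FE u1 j1; rewrite e12 /F tnth_mktuple /=.
    by case: eqP => [/val_inj-> ->|_ u11] //; have := s1 _ u1s; rewrite -u11.
  apply/negP => /allpairsP[[w i] /= [ws _ e1]].
  by have := FE w i; rewrite -e1 tnth_mktuple if_same => w1;
    have := s1 _ ws; rewrite -w1.
have -> : PAinv y = [set x | x \in L].
  apply/seteqP; split=> x.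
    move=> /PAinv_W[w [i [le_in]]]; rewrite W_superdecreasing => /= ws ->.
    rewrite inE; have [->|w1] := eqVneq w 1; first by rewrite one1 eqxx.
    apply/orP; right; apply/allpairsP.
    by exists (w, inord i); rewrite mem_rem_uniq ?uniq_subset_sums // inE w1 ws
      mem_enum /F inordK.
  rewrite /= inE => /orP[/eqP->|/allpairsP[[w i] /= [ws _ ->]]]; apply/PAinv_W.
    by exists 1, 0; rewrite W_superdecreasing.
  exists w, i; split=> //; first by rewrite -ltnS.
  by rewrite W_superdecreasing /=; apply: mem_rem ws.
have -> : 2 ^ n * n.+1 - n.+1 + 1 = size L.
  rewrite /= size_allpairs size_enum_ord size_rem // size_subset_sums addn1.
  by rewrite -subn1 mulnBl mul1n.
exact: card_uniq_seq.
Qed.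

End Superdecreasing.

(** The [2 ^ n] elements of [W y] come from a list of length [2 ^ n], so every listed sum lies in
    [W y] and none is repeated. First fit then recovers every subset from its sum. *)
Lemma card_W_maximal : W y #= `I_(2 ^ n) ->
  W y = [set w | w \in subset_sums y] /\ superdecreasing (behead y).
Proof.
move=> cW; set s := [seq w <- subset_sums y | `[< W y w >]].
have WE : W y = [set w | w \in undup s].
  apply/seteqP; split=> w /=; rewrite mem_undup mem_filter.
    by move=> Ww; rewrite W_sub_subset_sums // andbT; apply/asboolP.
  by case/andP=> /asboolP.
have szs : 2 ^ n = size (undup s).
  apply/card_eq_II; rewrite -(card_eqr (card_uniq_seq (undup_uniq s))) -WE.
  by rewrite card_eq_sym.
have ss : s = subset_sums y.
  apply/eqP; rewrite -(size_subseq_leqif (filter_subseq _ _)).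
  rewrite eqn_leq size_subseq ?filter_subseq // size_subset_sums szs.
  exact: size_undup.
have us : uniq (subset_sums y).
  rewrite -ss -[uniq s]negbK -ltn_size_undup -leqNgt -szs ss.
  by rewrite size_subset_sums.
have WsE : W y = [set w | w \in subset_sums y].
  by rewrite WE ss; apply/seteqP; split=> w /=; rewrite mem_undup.
split=> //; apply: superdecreasing_greedy => b szb.
have szy : size (behead y) = n by rewrite size_behead size_tuple.
have bn : size b == n by rewrite szb szy.
have gn : size (greedy (sumn (mask b (behead y))) (behead y)) == n.
  by rewrite size_greedy szy.
have inj : injective (fun b : n.-tuple bool => (sumn (mask b (behead y))).+1).
  by apply/injectiveP.
(* The first-fit mask and [b] have the same sum, since that sum plus 1 lies in [W y]. *)
suff : Tuple gn = Tuple bn by case.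
apply: inj => /=; apply/esym; apply: (W_subset_sum (w := _.+1)).
by rewrite WsE; apply/fintype.imageP; exists (Tuple bn).
Qed.

(** With the exceptional car second, the hole has the size of all lengths but the first, minus the
    first. The lengths from the third on must fill it, so the first is at least the second. *)
Lemma W_sum_behead : W y (sumn (behead y)).+1 -> nth 0 y 1 <= nth 0 y 0.
Proof.
case/(W_leftover y_gt0) => _ lw.
have [n0|n_gt0] := posnP n; first by rewrite nth_default // size_tuple n0.
have := leftover0_le (lw 1 n_gt0); rewrite [_.-1]/=.
by case: (tval y) => [|l [|l' s]] //=; rewrite drop0; lia.
Qed.

End Cardinality.

Theorem theorem5 (n : nat) (y : n.-tuple nat)
    (n_gt0 : 0 < n) (y_gt0 : forall i : 'I_n, 0 < tnth y i) :
  [/\ (~~ constant y ->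
         forall w : nat, W y w -> w <= \sum_(0 <= j < n.-1) nth 0 y j),
      (W y `<=` shifted_subset_sums y /\ W y #<= `I_(2 ^ n.-1)),
      ((forall j : nat, j < n.-1 -> \sum_(j.+1 <= i < n) nth 0 y i < nth 0 y j) ->
         [/\ W y = shifted_subset_sums y,
             W y #= `I_(2 ^ n.-1),
             PAinv y #= `I_(2 ^ n.-1 * n - n + 1)
           & PAinv_nondecreasing y #= `I_(2 ^ n.-1)])
    & (2 <= n -> W y #= `I_(2 ^ n.-1) ->
         [/\ W y = shifted_subset_sums y,
             nth 0 y 1 <= nth 0 y 0
           & forall j : nat, 0 < j < n.-1 -> \sum_(j.+1 <= i < n) nth 0 y i < nth 0 y j])].
Proof.
case: n n_gt0 y y_gt0 => // n _ y /all_tnthP y_gt0; rewrite [n.+1.-1]/=.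
have dropE j : \sum_(j <= i < n.+1) nth 0 y i = sumn (drop j y).
  by rewrite sumn_drop size_tuple.
split.
- move=> ncst w Ww; rewrite -sumn_take ?size_tuple //.
  exact: W_le.
- by rewrite shifted_subset_sumsE; split;
    [apply: W_sub_subset_sums | apply: card_W_le].
- move=> y_big; have y_sd : superdecreasing y.
    apply/superdecreasingP => j; rewrite size_tuple ltnS leq_eqVlt.
    (* The condition of (c) omits the last index, where the claim is that the last length is
       positive. *)
    case/orP=> [/eqP->|/y_big]; last by rewrite dropE.
    rewrite drop_oversize ?size_tuple //=.
    by apply: (all_nthP 0 y_gt0); rewrite size_tuple.
  rewrite shifted_subset_sumsE; split; first exact: W_superdecreasing.
  + exact: card_W.
  + exact: card_PAinv.
  + exact: card_PAinv_nondecreasing.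
- move=> _ cW; have [WE sd] := card_W_maximal y_gt0 cW.
  rewrite shifted_subset_sumsE; split=> //.
    (* The full sum of [behead y], given by the mask of ones, is among the subset sums. *)
    apply: (W_sum_behead y_gt0); rewrite WE; apply/fintype.imageP.
    exists [tuple of nseq n true] => //=.
    by rewrite mask_true // size_behead size_tuple.
  case=> // j jn; rewrite dropE -nth_behead.
  rewrite (_ : drop j.+2 y = drop j.+1 (behead y)); last first.
    by rewrite -drop1 drop_drop addn1.
  by move/superdecreasingP: sd; apply; rewrite size_behead size_tuple; lia.
Qed.
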